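(* Let $\mathcal{D}$ be a regular ultrafilter on the infinite cardinal $\lambda$, let $A$ be a graph-like $\varphi$-set in the structure $\mathcal{M}$, and let $\Gamma$ be the set of $\leq$-minimal isomorphism types of finite graphs not occurring in $\mathrm{isoSh}(A)$. The following are equivalent: (1) Every $(A)$-type of $\widehat{\mathcal{M}}:=\mathcal{M}^\lambda/\mathcal{D}$ of cardinality $\leq\lambda$ is realized. (2) If $(\mathbb{G}_\alpha)_{\alpha<\lambda}$ is a sequence of (possibly infinite) graphs such that $\gamma\not\leq\mathbb{G}_\alpha$ for every $\gamma\in\Gamma$ and $\alpha<\lambda$, then the ultraproduct $\mathbb{G}:=\prod_{\alpha<\lambda}\mathbb{G}_\alpha/\mathcal{D}$ has the property that every $H\subseteq\mathbb{G}$ inducing a complete subgraph with $|H|=\lambda$ is contained in an internal subset of $\mathbb{G}$ inducing a complete subgraph.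
   Context: Fix a formula $\varphi(\bar{x};\bar{y})$, $|\bar y|=n$. A $\varphi$-set in $\mathcal{M}$ is a nonempty $A\subseteq M^n$; it is graph-like if for every finite $B\subseteq A$ with $|B|\ge2$, $\{\varphi(\bar{x};\bar{a}):\bar{a}\in B\}$ is consistent iff $\{\varphi(\bar x;\bar a):\bar a\in C\}$ is consistent for every 2-element $C\subseteq B$. $\mathrm{Sh}(A)$ is the set of pairs $(\mathbb{G},\theta)$ with $\mathbb{G}$ a simple graph on $\{1,\dots,m\}$, $m\ge1$, $\theta:\{1,\dots,m\}\to A$, $\mathcal{M}\models\exists\bar{x}\,\varphi(\bar{x};\theta(i))$ for all $i$, and distinct $i,j$ adjacent iff $\mathcal{M}\models\exists\bar{x}(\varphi(\bar{x};\theta(i))\wedge\varphi(\bar{x};\theta(j)))$; $\mathrm{isoSh}(A)$ is the set of isomorphism types of such $\mathbb{G}$. $\mathbb{H}\le\mathbb{G}$ means there is an injective graph homomorphism $\mathbb{H}\to\mathbb{G}$ preserving non-edges. An $(A)$-type of $\widehat{\mathcal{M}}$ is a type $\{\varphi(\bar{x},\bar{a}_\beta):\beta<\kappa\}$ whose parameters have representatives $\bar{r}_\beta\in (M^n)^\lambda$ with $\bar{r}_\beta(\alpha)\in A$ for all $\alpha,\beta$. A subset of $\prod_\alpha\mathbb{G}_\alpha/\mathcal{D}$ is internal if it is $\prod_\alpha K_\alpha/\mathcal{D}$ for some $K_\alpha\subseteq G_\alpha$. *)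

(* Defs.v *)
From mathcomp Require Import all_boot.
From mathcomp Require Import all_classical.

Set Implicit Arguments.
Unset Strict Implicit.
Unset Printing Implicit Defensive.

Local Open Scope classical_set_scope.
Local Open Scope card_scope.

(** * First-order logic *)

Record language := Language {
  fsym : Type;
  farity : fsym -> nat;
  rsym : Type;
  rarity : rsym -> nat }.

Record structure (L : language) := Structure {
  carrier :> Type;
  fint : forall s : fsym L, ('I_(farity s) -> carrier) -> carrier;
  rint : forall s : rsym L, ('I_(rarity s) -> carrier) -> Prop;
  carrier_inhabited : inhabited carrier }.

(** [formula L V] is the type of first-order formulas with equality whose free
    variables are in [V].  In [Ex p], the bound variable is [None]. *)

Inductive term (L : language) (V : Type) : Type :=
| Var of V
| App (s : fsym L) of ('I_(farity s) -> term L V).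

Inductive formula (L : language) (V : Type) : Type :=
| Eq of term L V & term L V
| Rel (s : rsym L) of ('I_(rarity s) -> term L V)
| Not of formula L V
| And of formula L V & formula L V
| Ex of formula L (option V).

Arguments Var {L V}.
Arguments App {L V}.
Arguments Eq {L V}.
Arguments Rel {L V}.
Arguments Not {L V}.
Arguments And {L V}.
Arguments Ex {L V}.

Fixpoint eval (L : language) (M : structure L) (V : Type) (v : V -> M)
    (t : term L V) : M :=
  match t with
  | Var x => v x
  | App s ts => fint (fun j => eval v (ts j))
  end.

Definition scons (T V : Type) (x : T) (v : V -> T) (o : option V) : T :=
  if o is Some y then v y else x.

Fixpoint sat (L : language) (M : structure L) (V : Type) (v : V -> M)
    (p : formula L V) : Prop :=
  match p with
  | Eq t u => eval v t = eval v u
  | Rel s ts => rint (fun j => eval v (ts j))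
  | Not q => ~ sat v q
  | And q r => sat v q /\ sat v r
  | Ex q => exists x : M, sat (scons x v) q
  end.

Fixpoint trename (L : language) (V W : Type) (f : V -> W) (t : term L V) :
    term L W :=
  match t with
  | Var x => Var (f x)
  | App s ts => App s (fun j => trename f (ts j))
  end.

Fixpoint frename (L : language) (V W : Type) (f : V -> W) (p : formula L V) :
    formula L W :=
  match p with
  | Eq t u => Eq (trename f t) (trename f u)
  | Rel s ts => Rel s (fun j => trename f (ts j))
  | Not q => Not (frename f q)
  | And q r => And (frename f q) (frename f r)
  | Ex q => Ex (frename (omap f) q)
  end.

(** A formula in the free variables [x_0, ..., x_(k-1)] with parameters in [M]
    is a formula over ['I_k + M]: an element of [M] occurs in it as a variable
    which is always evaluated to itself. *)

Definition pformula (L : language) (M : structure L) (k : nat) : Type :=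
  formula L ('I_k + M).

Definition psat (L : language) (M : structure L) (k : nat) (b : 'I_k -> M)
    (p : pformula M k) : Prop :=
  sat (fun v : 'I_k + M => match v with inl i => b i | inr m => m end) p.

(** The formula phi(x; a), where ['I_k] indexes x and ['I_n] indexes y. *)
Definition inst (L : language) (M : structure L) (k n : nat)
    (phi : formula L ('I_k + 'I_n)) (a : 'I_n -> M) : pformula M k :=
  frename (fun v : 'I_k + 'I_n =>
    match v with inl i => inl i | inr j => inr (a j) end) phi.

Definition realized (L : language) (M : structure L) (k : nat)
    (p : set (pformula M k)) : Prop :=
  exists b : 'I_k -> M, forall psi, p psi -> psat b psi.

(** Consistency with the elementary diagram of [M], i.e. finite
    satisfiability in [M]. *)
Definition consistent (L : language) (M : structure L) (k : nat)
    (p : set (pformula M k)) : Prop :=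
  forall q : set (pformula M k), finite_set q -> q `<=` p -> realized q.

(** * Graphs *)

Record graph (V : Type) := Graph {
  adj :> V -> V -> Prop;
  adj_sym : forall x y, adj x y -> adj y x;
  adj_irrefl : forall x, ~ adj x x }.

Definition embeds (V W : Type) (H : graph V) (G : graph W) : Prop :=
  exists f : V -> W,
    [/\ injective f,
        (forall x y, H x y -> G (f x) (f y)) &
        (forall x y, ~ H x y -> ~ G (f x) (f y))].

Definition isomorphic (V W : Type) (H : graph V) (G : graph W) : Prop :=
  exists f : V -> W, bijective f /\ forall x y, H x y <-> G (f x) (f y).

Definition clique (V : Type) (G : graph V) (H : set V) : Prop :=
  forall x y, H x -> H y -> x <> y -> G x y.

(** Finite graphs are nonempty, hence the successor. *)
Record fin_graph := FinGraph {
  forder : nat;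
  fin_graph_graph :> graph 'I_forder.+1 }.

Definition iso_type (F : fin_graph) : set fin_graph :=
  [set F' : fin_graph | isomorphic F F'].

Definition is_iso_type : set (set fin_graph) := range iso_type.

Definition type_le (s t : set fin_graph) : Prop :=
  exists F F' : fin_graph, [/\ s F, t F' & embeds F F'].

Definition type_embeds (s : set fin_graph) (V : Type) (G : graph V) : Prop :=
  exists F : fin_graph, s F /\ embeds F G.

(** * Shapes of phi-sets *)

Definition graph_like (L : language) (M : structure L) (k n : nat)
    (phi : formula L ('I_k + 'I_n)) (A : set ('I_n -> M)) : Prop :=
  forall B : set ('I_n -> M), finite_set B -> B `<=` A -> `I_2 #<= B ->
    (consistent (inst phi @` B) <->
     forall C : set ('I_n -> M), C `<=` B -> C #= `I_2 ->
       consistent (inst phi @` C)).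

Definition Sh (L : language) (M : structure L) (k n : nat)
    (phi : formula L ('I_k + 'I_n)) (A : set ('I_n -> M))
    (F : fin_graph) (theta : 'I_(forder F).+1 -> ('I_n -> M)) : Prop :=
  [/\ forall i, A (theta i),
      forall i, exists b : 'I_k -> M, psat b (inst phi (theta i)) &
      forall i j, i <> j ->
        (F i j <-> exists b : 'I_k -> M,
           psat b (inst phi (theta i)) /\ psat b (inst phi (theta j)))].

Definition isoSh (L : language) (M : structure L) (k n : nat)
    (phi : formula L ('I_k + 'I_n)) (A : set ('I_n -> M)) : set (set fin_graph) :=
  iso_type @` [set F : fin_graph | exists theta, @Sh L M k n phi A F theta].

(** The set Gamma of minimal isomorphism types not in isoSh(A). *)
Definition min_omitted (L : language) (M : structure L) (k n : nat)
    (phi : formula L ('I_k + 'I_n)) (A : set ('I_n -> M)) : set (set fin_graph) :=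
  [set t | [/\ is_iso_type t, ~ isoSh phi A t &
     forall s, is_iso_type s -> ~ isoSh phi A s -> type_le s t -> s = t]].

(** * Ultraproducts *)

Definition regular (I : Type) (D : set_system I) : Prop :=
  exists E : set (set I),
    [/\ E `<=` D, E #= [set: I] &
        forall i : I, finite_set [set X | E X /\ X i]].

Section Ultraproduct.
Variables (I : Type) (D : set_system I).

Section Carrier.
Variable V : I -> Type.

Definition uclass (f : forall i, V i) : set (forall i, V i) :=
  [set g | D [set i | f i = g i]].

Definition ultraproduct : Type :=
  {C : set (forall i, V i) | exists f, C = uclass f}.

Definition upi (f : forall i, V i) : ultraproduct :=
  exist _ (uclass f) (ex_intro _ f erefl).

Definition urepr (x : ultraproduct) : forall i, V i := projT1 (cid (proj2_sig x)).

Definition internal (K : set ultraproduct) : Prop :=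
  exists K_ : forall i, set (V i),
    K = upi @` [set f | forall i, K_ i (f i)].

End Carrier.

(** When [D] is a filter, the interpretations of symbols and the adjacency
    relation below do not depend on the representatives picked by [urepr]. *)

Lemma ultrapower_inhabited (T : Type) :
  inhabited T -> inhabited (ultraproduct (fun _ : I => T)).
Proof. by case=> x; apply: inhabits; exact: (upi (fun=> x)). Qed.

Definition ultrapower (L : language) (M : structure L) : structure L :=
  @Structure L (ultraproduct (fun _ : I => M))
    (fun s a => upi (fun i => fint (fun j => urepr (a j) i)))
    (fun s a => D [set i | rint (fun j => urepr (a j) i)])
    (ultrapower_inhabited (carrier_inhabited M)).

Context {DF : UltraFilter D}.
Variables (V : I -> Type) (G : forall i, graph (V i)).

Definition ultra_adj (x y : ultraproduct V) : Prop :=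
  D [set i | G i (urepr x i) (urepr y i)].

Lemma ultra_adj_sym x y : ultra_adj x y -> ultra_adj y x.
Proof. by apply: filterS => i; exact: adj_sym. Qed.

Lemma ultra_adj_irrefl x : ~ ultra_adj x x.
Proof. by move=> xx; have [i xi] := filter_ex xx; exact: adj_irrefl xi. Qed.

Definition ultraproduct_graph : graph (ultraproduct V) :=
  Graph ultra_adj_sym ultra_adj_irrefl.

End Ultraproduct.

Arguments ultraproduct {I} D V.
Arguments upi {I D V}.
Arguments urepr {I D V}.
Arguments internal {I D V}.
Arguments ultrapower {I} D {L}.
Arguments ultraproduct_graph {I} D {DF V}.

(** An (A)-type of the ultrapower of [M]. *)
Definition A_type (I : Type) (D : set_system I) (L : language)
    (M : structure L) (k n : nat) (phi : formula L ('I_k + 'I_n))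
    (A : set ('I_n -> M)) (p : set (pformula (ultrapower D M) k)) : Prop :=
  consistent p /\
  exists P : set ('I_n -> ultrapower D M),
    p = inst phi @` P /\
    forall a, P a -> exists r : I -> 'I_n -> M,
      (forall i, A (r i)) /\ forall j, a j = upi (fun i => r i j).

(* Main.v *)
(** Fix sets [X_t] in [D], [t : I], such that each [i] lies in only finitely many
    of them.

    From types to cliques: at index [i] only the finitely many vertices
    [h_t(i)] with [i] in [X_t] matter.  Their induced subgraph omits Gamma,
    hence is the shape of a family [theta_i] in [A], and the parameters
    [theta_i(h_t(i))] give an (A)-type, consistent because [A] is graph-like.
    If [b] realizes it, the vertices [v] with [phi(b(i); theta_i(v))] form a
    clique for every [i].

    From cliques to types: the parameters of the type, distinguished by their
    index, form a clique in the ultrapower of the graph of compatibility on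
    [A].  An internal clique around it consists of pairwise compatible
    parameters at almost every [i], and those with [i] in [X_t] are finite in
    number, hence simultaneously realized. *)

Require Import Defs.
From HB Require Import structures.
From mathcomp Require Import all_boot.
From mathcomp Require Import all_classical.

Set Implicit Arguments.
Unset Strict Implicit.
Unset Printing Implicit Defensive.

Local Open Scope classical_set_scope.
Local Open Scope card_scope.

(** * Cardinality, finite sets and ultrafilters *)

Lemma card_eq_bij (T U : Type) (u0 : U) (A : set T) (B : set U) :
  A #= B -> exists f : T -> U, set_bij A B f.
Proof.
pose U' : pointedType :=
  HB.pack U (gen_eqMixin U) (gen_choiceMixin U) (isPointed.Build U u0).
by move/(@card_set_bijP T U' A B).
Qed.

Lemma card_le_range (T I : Type) (A : set T) :
  A !=set0 -> A #<= [set: I] -> exists g : I -> T, A = range g.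
Proof.
move=> [x0 Ax0].
pose T' : pointedType :=
  HB.pack T (gen_eqMixin T) (gen_choiceMixin T) (isPointed.Build T x0).
move/(@pcard_surjP T' I A)=> [g gA].
(* The surjection [g] covers [A] but may leave it; stray values are redirected to [x0]. *)
exists (fun i => if pselect (A (g i)) then g i else x0).
apply/seteqP; split=> [x Ax|_ [i _ <-]]; last by case: pselect.
by have [i _ gi] := gA x Ax; exists i => //; case: pselect; rewrite gi.
Qed.

Lemma finite_set_enum (T : Type) (X : set T) : finite_set X ->
  exists m (f : 'I_m -> T), injective f /\ X = range f.
Proof.
move/finite_setP=> [m Xm]; case: (pselect (X !=set0)) => [[x0 _]|X0].
  have [f [fX fi sf]] := card_eq_bij x0 (card_esym Xm).
  exists m, (fun i => f i); split=> [i j fij|].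
    by apply/val_inj/fi => //; rewrite inE /=.
  apply/seteqP; split=> [x /sf [i /= im <-]|_ [i _ <-]].
    by exists (Ordinal im).
  exact: (fX i (ltn_ord i)).
exists 0, (fun i : 'I_0 => match notF (ltn_ord i) with end).
split=> [[]//|]; apply/seteqP; split=> [x Xx|_ [[]//]].
by case: X0; exists x.
Qed.

Lemma card_ge2 (T : Type) (X : set T) x y : X x -> X y -> x <> y -> `I_2 #<= X.
Proof.
move=> Xx Xy xy; pose f k := if k == 0 then x else y.
have sub : f @` `I_2 `<=` X by move=> _ [[|[|//]] _ <-].
apply: card_le_trans (subset_card_le sub).
have /card_esym : f @` `I_2 #= `I_2.
  apply: inj_card_eq => i j; rewrite !inE /f /=.
  by case: i => [|[]] //; case: j => [|[]] //= _ _ /esym.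
by rewrite card_eq_le => /andP[].
Qed.

Lemma card_eq2 (T : Type) (C : set T) : C #= `I_2 -> exists x y, C = [set x; y].
Proof.
move/card_set_bijP=> [f [fC fi fs]].
have [x Cx fx] := fs 0 isT; have [y Cy fy] := fs 1 isT.
exists x, y; apply/seteqP; split=> [z Cz|z [->|->]] //.
have := fC z Cz; rewrite /=; case fz: (f z) => [|[|//]] _.
  by left; apply: fi; rewrite ?inE // fz fx.
by right; apply: fi; rewrite ?inE // fz fy.
Qed.

Lemma filter_finite_forall (J I : Type) (D : set_system I) (DF : Filter D)
    (S : set J) (P : J -> set I) :
  finite_set S -> (forall x, S x -> D (P x)) ->
  D [set i | forall x, S x -> P x i].
Proof.
move=> /finite_set_enum[m [f [_ ->]]] DP.
have : D [set i | forall l : 'I_m, P (f l) i].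
  by apply: filter_forall => l; apply: DP; exists l.
by apply: filterS => i Pi _ [l _ <-].
Qed.

Lemma ultra_forall (I : Type) (D : set_system I) (hD : UltraFilter D)
    (J : finType) (P : J -> set I) :
  (forall j, D (P j)) -> D [set i | forall j, P j i].
Proof. exact: filter_forall. Qed.

Lemma ultra_setC (I : Type) (D : set_system I) (hD : UltraFilter D)
    (P : set I) : D (~` P) <-> ~ D P.
Proof.
split=> [DC DP|nDP]; last by case: (in_ultra_setVsetC P hD).
by have [i [/= nP Pi]] := filter_ex (filterI DC DP).
Qed.

(** Inhabitance of [T] supplies the value of [f] at indices without a witness. *)
Lemma ultra_choice (I T : Type) (D : set_system I) (hD : UltraFilter D)
    (P : I -> T -> Prop) : inhabited T -> D [set i | exists x, P i x] ->
  exists f : I -> T, D [set i | P i (f i)].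
Proof.
move=> [x0] DP.
have /choice[f fP] : forall i, exists x, (exists y, P i y) -> P i x.
  move=> i; case: (pselect (exists y, P i y)) => [[x Px]|]; first by exists x.
  by exists x0.
by exists f; apply: filterS DP => i /fP.
Qed.

(** The regularizing family is reindexed by a bijection from [I]; injectivity keeps the set of
    indices [t] with [X t i] finite. *)
Lemma regular_cover (I : Type) (D : set_system I) : regular D ->
  exists X : I -> set I,
    (forall t, D (X t)) /\ forall i, finite_set [set t | X t i].
Proof.
move=> [E [ED EI Ef]].
have [X [XE Xi _]] := card_eq_bij set0 (card_esym EI).
exists X; split=> [t|i]; first exact/ED/XE.
apply: (@sub_finite_set _ _ (X @^-1` [set Y | E Y /\ Y i])).
  by move=> t Xti; split=> //; exact: XE.
by apply: finite_preimage => // s t _ _; apply: Xi; rewrite inE.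
Qed.

(** * Formulas in ultrapowers *)

Lemma eval_trename (L : language) (M : structure L) (V W : Type) (f : V -> W)
    (v : W -> M) (t : term L V) : eval v (trename f t) = eval (v \o f) t.
Proof.
by elim: t => //= s ts IH; congr fint; apply: funext => j; exact: IH.
Qed.

Lemma sat_frename (L : language) (M : structure L) (V W : Type) (f : V -> W)
    (v : W -> M) (p : formula L V) : sat v (frename f p) = sat (v \o f) p.
Proof.
elim: p W f v => {V} /= [V t u|V s ts|V q IH|V q IHq r IHr|V q IH] W f v.
- by rewrite !eval_trename.
- by congr rint; apply: funext => j; exact: eval_trename.
- by rewrite IH.
- by rewrite IHq IHr.
- congr ex; apply: funext => x; rewrite IH; congr sat.
  by apply: funext; case.
Qed.

Lemma urepr_upi (I : Type) (D : set_system I) (hD : UltraFilter D)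
    (V : I -> Type) (f : forall i, V i) : D [set i | urepr (upi f : ultraproduct D V) i = f i].
Proof.
rewrite /urepr; case: cid => /= g fg.
have : uclass D f g by rewrite fg; apply: filterS filterT.
by apply: filterS => i /= ->.
Qed.

Lemma eq_upi (I : Type) (D : set_system I) (hD : Filter D) (V : I -> Type)
    (f g : forall i, V i) :
  D [set i | f i = g i] -> upi f = upi g :> ultraproduct D V.
Proof.
move=> fg; apply: eq_exist; apply/seteqP; split=> h; apply: filterS2 fg.
  by move=> i /= <-.
by move=> i /= ->.
Qed.

Lemma upi_inj (I : Type) (D : set_system I) (hD : UltraFilter D)
    (V : I -> Type) (f g : forall i, V i) :
  upi f = upi g :> ultraproduct D V -> D [set i | f i = g i].
Proof.
move=> fg; have := urepr_upi hD f; rewrite fg => Df.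
by apply: filterS2 Df (urepr_upi hD g) => i /= <-.
Qed.

Lemma ureprK (I : Type) (D : set_system I) (V : I -> Type)
    (x : ultraproduct D V) : upi (urepr x) = x.
Proof.
by case: x => C Cf; apply: eq_exist; rewrite /urepr; case: cid.
Qed.

Lemma ultraproduct_adjP (I : Type) (D : set_system I) (hD : UltraFilter D)
    (V : I -> Type) (G : forall i, graph (V i)) (f g : forall i, V i) :
  ultraproduct_graph D G (upi f) (upi g) <-> D [set i | G i (f i) (g i)].
Proof.
have fE := urepr_upi hD f; have gE := urepr_upi hD g.
by rewrite /= /ultra_adj; split=> fg; apply: filterS3 fE gE fg => i /= <- <-.
Qed.

Lemma eval_ultrapower (I : Type) (D : set_system I) (hD : UltraFilter D)
    (L : language) (M : structure L) (V : Type) (v : V -> ultrapower D M)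
    (t : term L V) :
  D [set i | urepr (eval v t) i = eval (fun x => urepr (v x) i) t].
Proof.
elim: t => [x|s ts IH] /=; first by apply: filterS filterT.
have E := urepr_upi hD (fun i => fint (fun j => urepr (eval v (ts j)) i)).
apply: filterS2 E (ultra_forall hD IH) => i /= -> e.
by congr fint; apply: funext => j; exact: e.
Qed.

(** Łoś's theorem, by induction on the formula: negation uses that [D] is ultra, and the quantifier
    chooses witnesses index by index. *)
Lemma los (I : Type) (D : set_system I) (hD : UltraFilter D)
    (L : language) (M : structure L) (V : Type) (v : V -> ultrapower D M)
    (p : formula L V) :
  sat v p <-> D [set i | sat (fun x => urepr (v x) i) p].
Proof.
elim: p v => {V} [V t u|V s ts|V q IH|V q IHq r IHr|V q IH] v /=.
- have Et := eval_ultrapower hD v t; have Eu := eval_ultrapower hD v u.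
  split=> [tu|].
    by move: Et Eu; apply: filterS2 => i /= <- <-; rewrite tu.
  move=> tu; rewrite -(ureprK (eval v t)) -(ureprK (eval v u)); apply: eq_upi.
  by move: Et Eu tu; apply: filterS3 => i /= -> ->.
- have E := ultra_forall hD (fun j => eval_ultrapower hD v (ts j)).
  split; move: E; apply: filterS2 => i /= E; congr rint; apply: funext => j;
    by rewrite E.
- by rewrite IH -ultra_setC.
- rewrite IHq IHr; split=> [[]|qr]; first exact: filterS2.
  by split; move: qr; apply: filterS => i [].
- have sE i x : (fun o => urepr (scons x v o) i) =
      scons (urepr x i) (fun x => urepr (v x) i) by apply: funext; case.
  split=> [[x /IH]|Dq].
    by apply: filterS => i; rewrite /= sE; exists (urepr x i).
  have [f Df] := ultra_choice hD (carrier_inhabited M) Dq.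
  exists (upi f); apply/IH; apply: filterS2 (urepr_upi hD f) Df => i /=.
  by rewrite sE => ->.
Qed.

(** Frees Łoś's theorem from the representatives picked by [urepr]: as [V] is finite, they agree
    with [w] at all variables simultaneously on a set in [D]. *)
Lemma los_upi (I : Type) (D : set_system I) (hD : UltraFilter D)
    (L : language) (M : structure L) (V : finType) (w : I -> V -> M)
    (p : formula L V) :
  sat (fun x => upi (fun i => w i x) : ultrapower D M) p <->
  D [set i | sat (w i) p].
Proof.
rewrite los.
have E := ultra_forall hD (fun x => urepr_upi hD (fun i => w i x)).
split; move: E; apply: filterS2 => i /= E; congr sat; apply: funext => x;
  by rewrite E.
Qed.

Lemma psat_inst (L : language) (M : structure L) (k n : nat)
    (phi : formula L ('I_k + 'I_n)) (b : 'I_k -> M) (a : 'I_n -> M) :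
  psat b (inst phi a) =
  sat (fun v => match v with inl i => b i | inr j => a j end) phi.
Proof. by rewrite /psat /inst sat_frename; congr sat; apply: funext; case. Qed.

Lemma psat_inst_upi (I : Type) (D : set_system I) (hD : UltraFilter D)
    (L : language) (M : structure L) (k n : nat)
    (phi : formula L ('I_k + 'I_n)) (b : I -> 'I_k -> M) (a : I -> 'I_n -> M) :
  psat (fun l => upi (fun i => b i l) : ultrapower D M)
    (inst phi (fun j => upi (fun i => a i j) : ultrapower D M)) <->
  D [set i | psat (b i) (inst phi (a i))].
Proof.
pose w i (v : 'I_k + 'I_n) := match v with inl l => b i l | inr j => a i j end.
rewrite psat_inst (_ : [set i | _] = [set i | sat (w i) phi]); last first.
  by apply/seteqP; split=> i /=; rewrite psat_inst.
by rewrite -los_upi; split; congr sat; apply: funext; case.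
Qed.

(** * Finite shapes *)

Lemma isomorphic_sym (V W : Type) (H : graph V) (G : graph W) :
  isomorphic H G -> isomorphic G H.
Proof.
move=> [f [[g fK gK] fP]]; exists g; split; first by exists f.
by move=> x y; rewrite fP !gK.
Qed.

Lemma isomorphic_trans (U V W : Type) (F : graph U) (H : graph V)
    (G : graph W) : isomorphic F H -> isomorphic H G -> isomorphic F G.
Proof.
move=> [f [fb fP]] [g [gb gP]]; exists (g \o f); split; first exact: bij_comp.
by move=> x y; rewrite fP gP.
Qed.

Lemma isomorphic_embeds (V W : Type) (H : graph V) (G : graph W) :
  isomorphic H G -> embeds H G.
Proof.
move=> [f [fb fP]]; exists f; split=> [|x y /fP //|x y nH /fP //].
exact: bij_inj.
Qed.

Lemma embeds_trans (U V W : Type) (F : graph U) (H : graph V)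
    (G : graph W) : embeds F H -> embeds H G -> embeds F G.
Proof.
move=> [f [fi f1 f0]] [g [gi g1 g0]]; exists (g \o f).
split=> [|x y /f1/g1 //|x y /f0/g0 //]; exact: inj_comp.
Qed.

Lemma iso_type_self (F : fin_graph) : iso_type F F.
Proof. by exists id; split=> //; exists id. Qed.

Lemma eq_iso_type (F F' : fin_graph) :
  isomorphic F F' -> iso_type F = iso_type F'.
Proof.
move=> FF'; apply/seteqP; split=> H; last exact: isomorphic_trans.
exact/isomorphic_trans/isomorphic_sym.
Qed.

(** Compose [theta] with the embedding; injectivity keeps distinct vertices distinct, so the
    adjacency clause still applies. *)
Lemma Sh_embeds (L : language) (M : structure L) (k n : nat)
    (phi : formula L ('I_k + 'I_n)) (A : set ('I_n -> M)) (F F' : fin_graph) :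
  embeds F F' -> (exists theta, Sh phi A (F := F') theta) ->
  exists theta, Sh phi A (F := F) theta.
Proof.
move=> [f [fi f1 f0]] [theta [thA thc tha]]; exists (theta \o f).
split=> [i|i|i j ij] /=; [exact: thA|exact: thc|].
rewrite -tha; last by move=> /fi.
split=> [/f1 //|fij]; apply: contrapT => /f0; exact.
Qed.

Lemma isoSh_iso_type (L : language) (M : structure L) (k n : nat)
    (phi : formula L ('I_k + 'I_n)) (A : set ('I_n -> M)) (F : fin_graph) :
  isoSh phi A (iso_type F) <-> exists theta, Sh phi A (F := F) theta.
Proof.
split=> [[F' F'S e]|FS]; last by exists F.
apply: (Sh_embeds _ F'S); apply/isomorphic_embeds/isomorphic_sym.
by have := iso_type_self F; rewrite -e.
Qed.

(** Strong induction on the order: either a strictly smaller omitted graph embeds in [F], or the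
    type of [F] is itself minimal. *)
Lemma min_omitted_embeds (L : language) (M : structure L) (k n : nat)
    (phi : formula L ('I_k + 'I_n)) (A : set ('I_n -> M)) (F : fin_graph) :
  ~ (exists theta, Sh phi A (F := F) theta) ->
  exists gamma, min_omitted phi A gamma /\ type_embeds gamma F.
Proof.
have [m] := ubnP (forder F); elim: m F => // m IH F Fm FS.
case: (pselect (exists F' : fin_graph, [/\ forder F' < forder F, embeds F' F &
    ~ exists theta, Sh phi A (F := F') theta])) => [[F' [F'F eF' F'S]]|Fmin].
  have [|gamma [gammaP [F1 [gF1 F1F']]]] := IH F' _ F'S.
    exact: leq_trans F'F _.
  by exists gamma; split=> //; exists F1; split=> //; exact: embeds_trans eF'.
exists (iso_type F); split; last first.
  exists F; split; first exact: iso_type_self.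
  exact/isomorphic_embeds/iso_type_self.
split; [by exists F|by rewrite isoSh_iso_type|].
move=> _ [F0 _ <-] + [F1 [F2 [F01 FF2 F12]]].
rewrite (eq_iso_type F01) isoSh_iso_type => F1S.
apply: eq_iso_type.
have [f [fi f1 f0]] : embeds F1 F.
  exact/(embeds_trans F12)/isomorphic_embeds/isomorphic_sym.
exists f; split; last first.
  by move=> x y; split=> [/f1 //|fxy]; apply: contrapT => /f0; exact.
(* By [Fmin], the omitted graph [F1] is not smaller than [F], so the injection [f] is bijective. *)
apply: inj_card_bij => //; rewrite !card_ord ltnS leqNgt; apply/negP => lt.
by apply: Fmin; exists F1; split=> //; exists f.
Qed.

Lemma pullback_sym (U V : Type) (G : graph V) (f : U -> V) x y :
  G (f x) (f y) -> G (f y) (f x).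
Proof. exact: adj_sym. Qed.

Lemma pullback_irrefl (U V : Type) (G : graph V) (f : U -> V) x :
  ~ G (f x) (f x).
Proof. exact: adj_irrefl. Qed.

(** For injective [f], a copy of the subgraph induced on the range of [f]. *)
Definition pullback (U V : Type) (G : graph V) (f : U -> V) : graph U :=
  Graph (@pullback_sym U V G f) (@pullback_irrefl U V G f).

(** If the subgraph induced on [X] were not a shape, a minimal omitted graph would embed in it,
    hence in [G]. The case [v = w] holds because a shape uses only individually satisfiable
    parameters. *)
Lemma finite_shape (L : language) (M : structure L) (k n : nat)
    (phi : formula L ('I_k + 'I_n)) (A : set ('I_n -> M)) (hA0 : A !=set0)
    (V : Type) (G : graph V) (X : set V) :
  (forall gamma, min_omitted phi A gamma -> ~ type_embeds gamma G) ->
  finite_set X ->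
  exists theta : V -> 'I_n -> M,
    (forall v, A (theta v)) /\
    forall v w, X v -> X w ->
      (v = w \/ G v w <-> exists b : 'I_k -> M,
         psat b (inst phi (theta v)) /\ psat b (inst phi (theta w))).
Proof.
have [a0 Aa0] := hA0.
move=> Gom /finite_set_enum [[|m] [f [fi ->]]].
  (* Empty [X] is treated apart, since a [fin_graph] has at least one vertex. *)
  by exists (fun=> a0); split=> // v w [[]].
pose F := @FinGraph m (pullback G f).
have [th [thA thc tha]] : exists th, Sh phi A (F := F) th.
  apply: contrapT => /min_omitted_embeds[gamma [/Gom gG [F' [gF' F'F]]]].
  apply: gG; exists F'; split=> //; apply: embeds_trans F'F _.
  by exists f.
have /choice[g gP] : forall v, exists i, range f v -> f i = v.
  move=> v; case: (pselect (range f v)) => [[i _ <-]|]; first by exists i.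
  by exists ord0.
have gK i : g (f i) = i by apply: fi; apply: gP; exists i.
exists (th \o g); split=> [v|_ _ [i _ <-] [j _ <-]] /=; first exact: thA.
rewrite !gK; case: (eqVneq i j) => [->|/eqP ij].
  by split=> _; [have [b bP] := thc j; exists b|left].
rewrite -tha //; split=> [[/fi //|]//|]; by right.
Qed.

(** Graph-likeness speaks only of sets with at least two parameters, so the cases where [a] is
    constant on [S] or [S] is empty are handled directly. *)
Lemma graph_like_realize (L : language) (M : structure L) (k n : nat)
    (phi : formula L ('I_k + 'I_n)) (A : set ('I_n -> M))
    (hA : graph_like phi A) (J : Type) (S : set J) (a : J -> 'I_n -> M) :
  finite_set S -> (forall s, S s -> A (a s)) ->
  (forall s t, S s -> S t -> exists b : 'I_k -> M,
     psat b (inst phi (a s)) /\ psat b (inst phi (a t))) ->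
  exists b : 'I_k -> M, forall s, S s -> psat b (inst phi (a s)).
Proof.
move=> finS SA S2; have finB := finite_image a finS.
have BA : a @` S `<=` A by move=> _ [s Ss <-]; exact: SA.
case: (pselect (exists s t, [/\ S s, S t & a s <> a t])) => [[s [t [Ss St st]]]|S1].
  have B2 : `I_2 #<= a @` S.
    by apply: card_ge2 st; [exists s|exists t].
  have cB : consistent (inst phi @` (a @` S)).
    apply/(hA _ finB BA B2) => C CB /card_eq2[x [y Cxy]] q _ qC.
    have [s' Ss' xE] : (a @` S) x by apply: CB; rewrite Cxy; left.
    have [t' St' yE] : (a @` S) y by apply: CB; rewrite Cxy; right.
    have [b [bs bt]] := S2 _ _ Ss' St'; exists b => psi /qC.
    by rewrite Cxy => -[z [] -> <-]; rewrite -?xE -?yE.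
  (* The set of instances is finite, so consistency applies to the whole of it. *)
  have [b bP] := cB _ (finite_image _ finB) (@subset_refl _ _).
  by exists b => s' Ss'; apply: bP; exists (a s') => //; exists s'.
case: (pselect (S !=set0)) => [[s Ss]|S0].
  have [b [bs _]] := S2 s s Ss Ss; exists b => t St.
  suff <- : a s = a t by [].
  by apply: contrapT => st; apply: S1; exists s, t.
have [m0] := carrier_inhabited M.
by exists (fun=> m0) => s Ss; case: S0; exists s.
Qed.

(** * Types and cliques *)

Section ShapeGraph.
Variables (L : language) (M : structure L) (k n : nat).
Variables (phi : formula L ('I_k + 'I_n)) (A : set ('I_n -> M)) (I : Type).

(* Since shapes need not be injective, cloning the parameters by [I] creates no
   new finite shape, but it makes the cliques as large as [I]. *)
Definition shape_vertex : Type :=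
  ({c : 'I_n -> M | A c /\ exists b, psat b (inst phi c)} * I)%type.

Definition shape_adj (x y : shape_vertex) : Prop :=
  x <> y /\ exists b, psat b (inst phi (sval x.1)) /\ psat b (inst phi (sval y.1)).

Lemma shape_adj_sym x y : shape_adj x y -> shape_adj y x.
Proof. by move=> [xy [b [bx bz]]]; split; [exact/nesym|exists b]. Qed.

Lemma shape_adj_irrefl x : ~ shape_adj x x.
Proof. by case. Qed.

Definition shape_graph : graph shape_vertex :=
  Graph shape_adj_sym shape_adj_irrefl.

(** The first coordinates of an embedded copy of [gamma] form a [theta] placing [gamma] in [isoSh].
    Two clones of one parameter are adjacent, as [Sh] demands of a repeated satisfiable
    parameter. *)
Lemma shape_graph_omits gamma :
  min_omitted phi A gamma -> ~ type_embeds gamma shape_graph.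
Proof.
move=> [[F0 _ <-] nS _] [F [F0F [f [fi f1 f0]]]]; apply: nS.
rewrite (eq_iso_type F0F) isoSh_iso_type.
exists (fun i => sval (f i).1); split=> [i|i|i j ij].
- by case: (svalP (f i).1).
- by case: (svalP (f i).1).
- split=> [/f1 []//|bP]; apply: contrapT => /f0; apply.
  by split=> // /fi.
Qed.

End ShapeGraph.

(** Otherwise, distinct non-adjacent pairs chosen at almost every index give two distinct
    non-adjacent members of the internal set. Nonemptiness of [K_ i] provides a pair at the other
    indices. *)
Lemma internal_clique (I : Type) (D : set_system I) (hD : UltraFilter D)
    (V : Type) (G : I -> graph V) (K_ : I -> set V) :
  (forall i, K_ i !=set0) ->
  clique (ultraproduct_graph D G) (upi @` [set f | forall i, K_ i (f i)]) ->
  D [set i | clique (G i) (K_ i)].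
Proof.
move=> K0 Kc; apply: contrapT => /(ultra_setC hD) nc.
have /choice[f fP] : forall i, exists xy : V * V, [/\ K_ i xy.1, K_ i xy.2 &
    ~ clique (G i) (K_ i) -> xy.1 <> xy.2 /\ ~ G i xy.1 xy.2].
  move=> i; have [x Kx] := K0 i.
  case: (pselect (clique (G i) (K_ i))) => [Gc|]; first by exists (x, x).
  move=> /existsNP[y /existsNP[z /not_implyP[Ky /not_implyP[Kz]]]].
  by move=> /not_implyP[yz nG]; exists (y, z).
pose f1 i := (f i).1; pose f2 i := (f i).2.
have f12 : upi f1 <> upi f2 :> ultraproduct D (fun=> V).
  move=> /(upi_inj hD) e; have [i [/= ei ni]] := filter_ex (filterI e nc).
  by case: (fP i) => _ _ /(_ ni) [].
have : ultraproduct_graph D G (upi f1) (upi f2).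
  by apply: Kc f12; [exists f1|exists f2] => // i; case: (fP i).
move=> /ultraproduct_adjP e; have [i [/= ei ni]] := filter_ex (filterI e nc).
by case: (fP i) => _ _ /(_ ni) [].
Qed.

Lemma clique_internal_of_realized (I : Type) (hI : infinite_set [set: I])
    (D : set_system I) (hD : UltraFilter D) (hreg : regular D)
    (L : language) (M : structure L) (k n : nat)
    (phi : formula L ('I_k + 'I_n))
    (A : set ('I_n -> M)) (hA0 : A !=set0) (hA : graph_like phi A) :
  (forall p : set (pformula (ultrapower D M) k),
      A_type phi A p -> p #<= [set: I] -> realized p) ->
  forall (V : I -> Type) (G : forall i, graph (V i)),
    (forall gamma, min_omitted phi A gamma ->
       forall i, ~ type_embeds gamma (G i)) ->
    forall H : set (ultraproduct D V),
      clique (ultraproduct_graph D G) H -> H #= [set: I] ->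
      exists K : set (ultraproduct D V),
        [/\ internal K, H `<=` K & clique (ultraproduct_graph D G) K].
Proof.
move=> real V G Gom H Hc HI.
have H0 : H !=set0.
  apply/set0P/eqP => H0; apply: hI.
  by rewrite -(eq_finite_set HI) H0; exact: finite_set0.
have [h HE] : exists h : I -> _, H = range h.
  by apply: card_le_range H0 _; move: HI; rewrite card_eq_le => /andP[].
have [t0] : inhabited I by move: H0; rewrite HE => -[_ [t _ _]]; exists.
have [X [DX Xf]] := regular_cover hreg.
(* [F i] is the finite set of vertices that matter at index [i]. *)
pose hr t i := urepr (h t) i; pose F i := hr^~ i @` [set t | X t i].
have shape i := cid (finite_shape hA0 (fun g gP => Gom g gP i)
  (finite_image (hr^~ i) (Xf i))).
pose th i := projT1 (shape i).
have thA i v : A (th i v) := (projT2 (shape i)).1 v.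
have thP i v w : F i v -> F i w -> (v = w \/ G i v w <-> exists b : 'I_k -> M,
    psat b (inst phi (th i v)) /\ psat b (inst phi (th i w))).
  exact: (projT2 (shape i)).2.
pose a t i := th i (hr t i).
pose ah t : 'I_n -> ultrapower D M := fun j => upi (fun i => a t i j).
have a2 s t : D [set i | exists b : 'I_k -> M,
    psat b (inst phi (a s i)) /\ psat b (inst phi (a t i))].
  have st : D [set i | hr s i = hr t i \/ G i (hr s i) (hr t i)].
    case: (pselect (h s = h t)) => [e|ne].
      by apply: filterS filterT => i _; left; rewrite /hr e.
    have : ultraproduct_graph D G (h s) (h t).
      by apply: Hc ne; rewrite HE; [exists s|exists t].
    by apply: filterS => i; right.
  apply: filterS3 (DX s) (DX t) st => i Xs Xt /thP; apply; [exists s|exists t] => //.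
(* A finite part [q] involves finitely many indices [c psi]. Their parameters are pairwise
   compatible on one common set in [D], where graph-likeness gives a joint realization. *)
have ac : consistent (inst phi @` range ah).
  move=> q finq qp.
  have /choice[c cP] : forall psi, exists t, q psi -> inst phi (ah t) = psi.
    move=> psi; case: (pselect (q psi)) => [/qp [_ [t _ <-] <-]|].
      by exists t.
    by exists t0.
  have finS := finite_image c finq.
  have DS : D [set i | exists b : 'I_k -> M,
      forall t, (c @` q) t -> psat b (inst phi (a t i))].
    have : D [set i | forall s, (c @` q) s -> forall t, (c @` q) t ->
        exists b : 'I_k -> M,
          psat b (inst phi (a s i)) /\ psat b (inst phi (a t i))].
      apply: filter_finite_forall => // s _.
      by apply: filter_finite_forall => // t _; exact: a2.
    apply: filterS => i Si; apply: (graph_like_realize hA finS) => [s _|s t Ss St].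
      exact: thA.
    exact: Si.
  have [m0] := carrier_inhabited M.
  have [b bP] := ultra_choice hD (inhabits (fun=> m0)) DS.
  exists (fun l => upi (fun i => b i l)) => psi qpsi.
  rewrite -(cP _ qpsi); apply/psat_inst_upi; apply: filterS bP => i /=.
  by apply; exists psi.
have [b bP] : realized (inst phi @` range ah).
  apply: real; last first.
    exact: card_le_trans (card_image_le _ _) (card_image_le _ _).
  split=> //; exists (range ah); split=> // _ [t _ <-].
  by exists (a t); split=> // i; exact: thA.
pose b_ i l := urepr (b l) i.
have bE : b = fun l => upi (fun i => b_ i l).
  by apply: funext => l; rewrite -[LHS]ureprK.
have bD t : D [set i | psat (b_ i) (inst phi (a t i))].
  apply/psat_inst_upi; rewrite -bE.
  by apply: bP; exists (ah t) => //; exists t.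
pose K0 i := [set v | F i v /\ psat (b_ i) (inst phi (th i v))].
(* Where [K0 i] is empty, the single vertex [hr t0 i] replaces it: [K_ i] is then never empty, and
   no new pair of distinct vertices arises. *)
pose K_ i := K0 i `|` [set v | ~ (K0 i !=set0) /\ v = hr t0 i].
have Kne i : exists v, K_ i v.
  case: (pselect (K0 i !=set0)) => [[v Kv]|nK]; first by exists v; left.
  by exists (hr t0 i); right.
exists (upi @` [set f | forall i, K_ i (f i)]); split; first by exists K_.
- rewrite HE => _ [t _ <-].
  (* Membership in the internal set asks for a representative in [K_ i] at every index, so [hr t] is
     corrected off a set in [D]. *)
  exists (fun i => if pselect (K_ i (hr t i)) then hr t i
                   else projT1 (cid (Kne i))).
    by move=> i; case: pselect => //= _; exact: (projT2 (cid (Kne i))).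
  rewrite -[RHS]ureprK; apply: eq_upi; apply: filterS2 (DX t) (bD t) => i Xt bt /=.
  case: pselect => // nK; case: nK; left; split=> //; by exists t.
- move=> _ _ [f fK <-] [g gK <-] fg; apply/ultraproduct_adjP.
  have : D (~` [set i | f i = g i]).
    by apply/ultra_setC => /eq_upi; exact: fg.
  (* Two vertices of [K0 i] are compatible through [b_ i], hence equal or adjacent; a replacement
     vertex would be the only element of [K_ i]. *)
  apply: filterS => i /= nfg; have := gK i; have := fK i.
  case=> [[Ff pf]|[nK fE]] [[Fg pg]|[nK' gE]].
  + have /thP[] // : exists b : 'I_k -> M, psat b (inst phi (th i (f i))) /\
        psat b (inst phi (th i (g i))) by exists (b_ i).
  + by case: nK'; exists (f i).
  + by case: nK; exists (g i).
  + by case: nfg; rewrite fE gE.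
Qed.

Lemma realized_of_clique_internal (I : Type)
    (D : set_system I) (hD : UltraFilter D) (hreg : regular D)
    (L : language) (M : structure L) (k n : nat)
    (phi : formula L ('I_k + 'I_n))
    (A : set ('I_n -> M)) (hA : graph_like phi A) :
  (forall (V : I -> Type) (G : forall i, graph (V i)),
    (forall gamma, min_omitted phi A gamma ->
       forall i, ~ type_embeds gamma (G i)) ->
    forall H : set (ultraproduct D V),
      clique (ultraproduct_graph D G) H -> H #= [set: I] ->
      exists K : set (ultraproduct D V),
        [/\ internal K, H `<=` K & clique (ultraproduct_graph D G) K]) ->
  forall p : set (pformula (ultrapower D M) k),
    A_type phi A p -> p #<= [set: I] -> realized p.
Proof.
move=> cli p [pc [P [pP Prep]]] pI.
case: (pselect (p !=set0)) => [p0|p0]; last first.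
  have [m0] := carrier_inhabited (ultrapower D M).
  by exists (fun=> m0) => psi ppsi; case: p0; exists psi.
have [g pg] := card_le_range p0 pI.
have [t0] : inhabited I by move: p0; rewrite pg => -[_ [t _ _]]; exists.
have /choice[r rP] : forall t, exists r : I -> 'I_n -> M, (forall i, A (r i)) /\
    g t = inst phi (fun j => upi (fun i => r i j) : ultrapower D M).
  move=> t; have : p (g t) by rewrite pg; exists t.
  rewrite pP => -[a /Prep[r [rA ar]] <-]; exists r; split=> //.
  by congr inst; apply: funext => j; rewrite ar.
(* Realize the pair [g s], [g t] by consistency and apply Łoś's theorem. The case [s = t] says that
   each parameter is satisfiable almost everywhere. *)
have r2 s t : D [set i | exists b : 'I_k -> M,
    psat b (inst phi (r s i)) /\ psat b (inst phi (r t i))].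
  have [] := pc [set g s; g t].
  - exact: finite_set2.
  - by rewrite pg => psi [] ->; [exists s|exists t].
  move=> b bP; pose b_ i l := urepr (b l) i.
  have bE : b = fun l => upi (fun i => b_ i l).
    by apply: funext => l; rewrite -[LHS]ureprK.
  have := bP _ (or_introl erefl); rewrite (rP s).2 bE => /psat_inst_upi Ds.
  have := bP _ (or_intror erefl); rewrite (rP t).2 bE => /psat_inst_upi Dt.
  by apply: filterS2 Ds Dt => i ps pt; exists (b_ i).
have [v0] : inhabited
    {c : 'I_n -> M | A c /\ exists b : 'I_k -> M, psat b (inst phi c)}.
  have [i [b [bs _]]] := filter_ex (r2 t0 t0).
  by exists; exists (r t0 i); split; [exact: (rP t0).1|exists b].
(* Vertices must carry satisfiable parameters, so [r t i] gives way to the default [v0] at the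
   exceptional indices. *)
pose rv t i := if pselect (A (r t i) /\ exists b : 'I_k -> M,
  psat b (inst phi (r t i))) is left c then exist _ (r t i) c else v0.
have rvD t : D [set i | sval (rv t i) = r t i].
  apply: filterS (r2 t t) => i [b [bt _]]; rewrite /rv /=.
  case: pselect => // -[]; split; [exact: (rP t).1|by exists b].
(* The tag [t] keeps the classes distinct even when parameters repeat, so the clique has exactly the
   cardinality of [I]. *)
pose hv t i : shape_vertex phi A I := (rv t i, t).
pose G (_ : I) := shape_graph phi A I.
have hv_inj : injective (fun t => upi (hv t) : ultraproduct D (fun=> _)).
  by move=> s t /(upi_inj hD) e; have [i [_]] := filter_ex e.
have Hc : clique (ultraproduct_graph D G) (range (fun t => upi (hv t))).
  move=> _ _ [s _ <-] [t _ <-] st; apply/ultraproduct_adjP.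
  apply: filterS3 (rvD s) (rvD t) (r2 s t) => i /= es et b2.
  split=> [[_ e]|]; first by apply: st; rewrite e.
  by rewrite /= es et.
have HI : range (fun t => upi (hv t) : ultraproduct D (fun=> _)) #= [set: I].
  by apply: inj_card_eq => s t _ _; exact: hv_inj.
have [K [[K_ KE] HK Kc]] :=
  cli _ G (fun g gP i => shape_graph_omits gP) _ Hc HI.
have hvK t : exists2 f, (forall i, K_ i (f i)) & D [set i | f i = hv t i].
  have : K (upi (hv t)) by apply: HK; exists t.
  by rewrite KE => -[f fK /(upi_inj hD) fE]; exists f.
have Kcl : D [set i | clique (G i) (K_ i)].
  apply: (@internal_clique I D hD _ G); last by rewrite -KE.
  by move=> i; have [f fK _] := hvK t0; exists (f i).
have [X [DX Xf]] := regular_cover hreg.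
(* Where [K_ i] is not a clique the bracketed condition is void and any tuple serves; elsewhere
   finitely many pairwise compatible parameters are realized together. *)
have /choice[b bP] : forall i, exists b : 'I_k -> M, forall t,
    [/\ X t i, clique (G i) (K_ i) & K_ i (hv t i)] ->
    psat b (inst phi (sval (rv t i))).
  move=> i; apply: (@graph_like_realize _ _ _ _ _ _ hA I
    [set t | [/\ X t i, clique (G i) (K_ i) & K_ i (hv t i)]]).
  - by apply: sub_finite_set (Xf i) => t [].
  - by move=> t _; case: (svalP (rv t i)).
  - move=> s t [_ cK Ks] [_ _ Kt].
    case: (pselect (hv s i = hv t i)) => [[-> _]|st].
      by have [_ [b bt]] := svalP (rv t i); exists b.
    by case: (cK _ _ Ks Kt st).
exists (fun l => upi (fun i => b i l)); rewrite pg => _ [t _ <-].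
rewrite (rP t).2; apply/psat_inst_upi; have [f fK fE] := hvK t.
(* Almost everywhere [X t i] holds, [K_ i] is a clique containing [hv t i], and [rv t i] is the
   original parameter. *)
apply: filterS3 (filterI (DX t) Kcl) fE (rvD t) => i [Xt Kt] /= fi <-.
by apply: bP; split=> //; rewrite -fi.
Qed.

Theorem theorem7p17 (I : Type) (hI : infinite_set [set: I])
    (D : set_system I) (hD : UltraFilter D) (hreg : regular D)
    (L : language) (M : structure L) (k n : nat)
    (phi : formula L ('I_k + 'I_n))
    (A : set ('I_n -> M)) (hA0 : A !=set0) (hA : graph_like phi A) :
  (forall p : set (pformula (ultrapower D M) k),
      A_type phi A p -> p #<= [set: I] -> realized p)
  <->
  (forall (V : I -> Type) (G : forall i, graph (V i)),
      (forall gamma, min_omitted phi A gamma ->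
         forall i, ~ type_embeds gamma (G i)) ->
      forall H : set (ultraproduct D V),
        clique (ultraproduct_graph D G) H -> H #= [set: I] ->
        exists K : set (ultraproduct D V),
          [/\ internal K, H `<=` K & clique (ultraproduct_graph D G) K]).
Proof.
split; first exact: clique_internal_of_realized.
exact: realized_of_clique_internal.
Qed.
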